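(* Let $n\ge3$, let $p\in[3,n]$ be an integer, and let $\{x^k\}$ and $\{\mathcal{I}_k\}$ be generated by the random block coordinate descent - diagonal band algorithm (described in the context) applied to the optimal transport linear program. Then the expected Gauss-Southwell-q rule holds: for all $k\ge0$, $$\mathbb{E}[q(x^k;\mathcal{I}_k)\mid\mathcal{F}_k]\le v\,q(x^k;\mathcal{N}),$$ with a constant $v\in(0,1]$ satisfying $v\ge\frac{n(p-2)}{(n^2-3)(n!)^2}$. Therefore, for any optimal solution $x^*$, $c^T(x^k-x^* )\to0$ almost surely and $\mathbb{E}[c^T(x^k-x^* )]$ converges to $0$ exponentially with rate $1-v$, i.e. $\mathbb{E}[c^T(x^k-x^* )]\le(1-v)^k\,\mathbb{E}[c^T(x^0-x^* )]$ for all $k\ge0$.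
   Context: For $X\in\mathbb{R}^{n\times n}$, $\operatorname{vec}(X)\in\mathbb{R}^{n^2}$ is the vector obtained by stacking the columns $X(:,1),\dots,X(:,n)$; $\operatorname{supp}$ of a vector is the set of indices of its nonzero entries. Let $N=n^2$, $\mathcal{N}=\{1,\dots,N\}$, and let $A\in\mathbb{R}^{2n\times n^2}$ be $$A=\begin{pmatrix} I_n & I_n & \cdots & I_n\\ \mathbf 1_n^T & & & \\ & \mathbf 1_n^T & & \\ & & \ddots & \\ & & & \mathbf 1_n^T\end{pmatrix}\quad(n\text{ column blocks}),$$ where $I_n$ is the identity and $\mathbf 1_n\in\mathbb{R}^n$ the all-ones vector. Let $b=((r^1)^T,(r^2)^T)^T$ with $r^1,r^2\in\mathbb{R}^n_+$, and $c=\operatorname{vec}(C)$ with $C\in\mathbb{R}^{n\times n}$ a cost matrix. The optimal transport linear program is $\min c^Tx$ subject to $Ax=b$, $x\ge0$; it is assumed to have an optimal solution. Let $\mathcal{X}=\{x\in\mathbb{R}^N: Ax=b,\ x\ge0\}$. For $x\in\mathcal{X}$ and $\mathcal{I}\subseteq\mathcal{N}$, let $\mathcal{D}(x;\mathcal{I})$ and $q(x;\mathcal{I})$ denote respectively the set of optimal solutions and the optimal value of $$\min_{d\in\mathbb{R}^N}\{c^Td : x+d\ge 0,\ Ad=0,\ d_i=0\ \ \forall i\in\mathcal{N}\setminus\mathcal{I}\}.$$ Diagonal band selection with width $p$: let $G\in\mathbb{R}^{n\times n}$ have $G(i,j)=1$ if either $j\in[1,n-p+1]$ and $i\in[j,j+p-1]$,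 or $j\in[n-p+2,n]$ and $i\in[1,j+p-n-1]\cup[j,n]$ (integer intervals), and $G(i,j)=0$ otherwise. Obtain $\bar D^k$ by uniformly randomly permuting all rows and all columns of $G$ (independent uniform row and column permutations, independent of the past), and set $\mathcal{I}_k=\operatorname{supp}(\operatorname{vec}(\bar D^k))$. Random block coordinate descent - diagonal band: start from a feasible $x^0\in\mathcal{X}$. At each iteration $k=0,1,2,\dots$: (1) choose $\mathcal{I}_k$ by the diagonal band selection; (2) find any $d^k\in\mathcal{D}(x^k;\mathcal{I}_k)$; (3) set $x^{k+1}=x^k+d^k$. Here $\mathcal{F}_k=\{x^0,\dots,x^k\}$ denotes the history of the algorithm. *)

(* Defs.v *)
From HB Require Import structures.
From mathcomp Require Import all_boot all_order all_algebra all_fingroup.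
From mathcomp Require Import all_classical all_reals all_analysis.

Set Implicit Arguments.
Unset Strict Implicit.
Unset Printing Implicit Defensive.

Import Order.TTheory GRing.Theory Num.Theory.
Import numFieldNormedType.Exports.

Local Open Scope classical_set_scope.
Local Open Scope ring_scope.

Section OptimalTransport.
Variable R : realType.

(* [mxvec] lists the rows of a matrix, hence the transpose of the argument. *)
Definition vec n (X : 'M[R]_n) : 'cV[R]_(n * n) := (mxvec X^T)^T.

Definition vsupp N (x : 'cV[R]_N) : {set 'I_N} := [set l | x l 0 != 0]%SET.

(* Column l of the matrix lies in column block l %/ n, at position l %% n. *)
Definition otA n : 'M[R]_(n + n, n * n) :=
  col_mx (\matrix_(i < n, l < n * n) ((l %% n)%N == i)%:R)
         (\matrix_(j < n, l < n * n) ((l %/ n)%N == j)%:R).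

Definition nonneg N (x : 'cV[R]_N) : Prop := forall l, 0 <= x l 0.

Definition cost N (c x : 'cV[R]_N) : R := (c^T *m x) 0 0.

Definition ot_feasible n (b : 'cV[R]_(n + n)) (x : 'cV[R]_(n * n)) : Prop :=
  otA n *m x = b /\ nonneg x.

Definition ot_optimal n (b : 'cV[R]_(n + n)) (c x : 'cV[R]_(n * n)) : Prop :=
  ot_feasible b x /\ forall y, ot_feasible b y -> cost c x <= cost c y.

Definition dir_feasible n (x : 'cV[R]_(n * n)) (I : {set 'I_(n * n)})
    (d : 'cV[R]_(n * n)) : Prop :=
  [/\ nonneg (x + d), otA n *m d = 0 & forall l, l \notin I -> d l 0 = 0].

Definition Dopt n (c x : 'cV[R]_(n * n)) (I : {set 'I_(n * n)})
    (d : 'cV[R]_(n * n)) : Prop :=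
  dir_feasible x I d /\
  forall d', dir_feasible x I d' -> cost c d <= cost c d'.

Definition qval n (c x : 'cV[R]_(n * n)) (I : {set 'I_(n * n)}) : R :=
  inf [set cost c d | d in [set d | dir_feasible x I d]].

(* The indices i and j of this predicate start at 1. *)
Definition in_band (n p i j : nat) : bool :=
  [|| [&& 1 <= j <= n - p + 1 & j <= i <= j + p - 1]
    | [&& n - p + 2 <= j <= n
        & (1 <= i <= j + p - n - 1) || (j <= i <= n)]]%N.

Definition bandG n p : 'M[R]_n := \matrix_(i, j) (in_band n p i.+1 j.+1)%:R.

Definition band_select n p (s t : 'S_n) : {set 'I_(n * n)} :=
  vsupp (vec (row_perm s (col_perm t (bandG n p)))).

End OptimalTransport.
Arguments otA R n : clear implicits.
Arguments bandG R n p : clear implicits.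
Arguments band_select R n p s t : clear implicits.

Section Probability.
Context {R : realType} {disp : measure_display} {T : measurableType disp}.
Variable P : probability T R.

Definition rand_vec N (x : T -> 'cV[R]_N) : Prop :=
  forall l, measurable_fun setT (fun w => x w l 0).

(* The sigma-algebra generated by x 0, ..., x k. *)
Definition history N (x : nat -> T -> 'cV[R]_N) (k : nat) : set (set T) :=
  <<s [set A | exists i l (B : set R), [/\ (i <= k)%N, measurable B &
                 A = (fun w => x i w l 0) @^-1` B]] >>.

(* Y is a version of the conditional expectation of Z given the
   sub-sigma-algebra F. *)
Definition is_cond_expectation (F : set (set T)) (Z Y : T -> R) : Prop :=
  [/\ P.-integrable setT (EFin \o Z),
      P.-integrable setT (EFin \o Y),
      forall B : set R, measurable B -> F (Y @^-1` B) &
      forall A, F A ->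
        (\int[P]_(w in A) (Y w)%:E = \int[P]_(w in A) (Z w)%:E)%E].

Definition uniform_perm n (s : T -> 'S_n) : Prop :=
  forall u, measurable (s @^-1` [set u]) /\
            P (s @^-1` [set u]) = ((n`!)%:R^-1)%:E.

(* Mutual independence of s, t and F. As F contains the whole space, the
   product rule for triples implies the one for pairs. *)
Definition indep_perms n (s t : T -> 'S_n) (F : set (set T)) : Prop :=
  forall (U V : set 'S_n) A, F A ->
    (P (s @^-1` U `&` t @^-1` V `&` A) =
     P (s @^-1` U) * P (t @^-1` V) * P A)%E.

(* Runs of random block coordinate descent with diagonal bands of width p:
   s k and t k are the row and column permutations drawn at iteration k, and
   d k is the chosen optimal direction. *)
Record rbcd_band n (p : nat) (b : 'cV[R]_(n + n)) (c : 'cV[R]_(n * n))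
    (s t : nat -> T -> 'S_n) (d x : nat -> T -> 'cV[R]_(n * n)) : Prop :=
  RbcdBand {
    rbcd_rand : forall k, rand_vec (x k) ;
    rbcd_init : forall w, ot_feasible b (x 0%N w) ;
    rbcd_row : forall k, uniform_perm (s k) ;
    rbcd_col : forall k, uniform_perm (t k) ;
    rbcd_indep : forall k, indep_perms (s k) (t k) (history x k) ;
    rbcd_dir : forall k w,
      Dopt c (x k w) (band_select R n p (s k w) (t k w)) (d k w) ;
    rbcd_step : forall k w, x k.+1 w = x k w + d k w }.

End Probability.

(* Main.v *)
(** A feasible direction [d] is a matrix with zero row and column sums, and is a
    conformal nonnegative combination of at most n^2 - 3 cycles of the bipartite
    graph rows/columns; hence one weighted cycle is a feasible direction whose
    cost is at most [cost c d / (n^2 - 3)].  The vertices of a cycle can be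
    renumbered so that adjacent ones have indices differing by at most 1, which
    places the cycle inside the cyclic band of width 3, and therefore inside the
    band of width p for n (p - 2) pairs of permutations.  Averaging the optimal
    values over all (n!)^2 pairs gives the Gauss-Southwell inequality pointwise.
    This average is a version of the conditional expectation by independence;
    it is measurable with respect to the history because, rounding the weights
    of the cycles down, [qval c x I < a] is witnessed by one of countably many
    rational directions.  The optimality gap is nonincreasing along each run,
    and its mean decreases by the factor 1 - v at each step, so its pointwise
    limit is almost surely 0. *)

Require Import Defs.
From HB Require Import structures.
From mathcomp Require Import all_boot all_order all_algebra all_fingroup.
From mathcomp Require Import all_classical all_reals all_analysis.
From mathcomp Require Import measurable_realfun.
From mathcomp Require Import zify ring lra.

Set Implicit Arguments.
Unset Strict Implicit.
Unset Printing Implicit Defensive.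

Import Order.TTheory GRing.Theory Num.Theory.
Import numFieldNormedType.Exports.

Local Open Scope classical_set_scope.
Local Open Scope ring_scope.

(** * Cycles in circulations *)

(** By induction on [L]: composing with the transposition of [s (f L)] and [g L] corrects the value
    at [f L] and, by injectivity, moves none of the earlier values. *)
Lemma perm_extends (T : finType) (L : nat) (f g : nat -> T) :
  {in gtn L &, injective f} -> {in gtn L &, injective g} ->
  exists s : {perm T}, forall a, (a < L)%N -> s (f a) = g a.
Proof.
elim: L => [|L IH] injf injg; first by exists 1%g.
have inS (h : nat -> T) : {in gtn L.+1 &, injective h} -> {in gtn L &, injective h}.
  by move=> injh a b; rewrite !inE => aL bL; apply: injh; rewrite inE ltnS ltnW.
have [s sE] := IH (inS _ injf) (inS _ injg).
exists (s * tperm (s (f L)) (g L))%g => a; rewrite ltnS leq_eqVlt permM.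
case: eqP => [-> _|_ /= aL]; first by rewrite tpermL.
have aL' : a \in gtn L.+1 by rewrite inE ltnW.
have LL : L \in gtn L.+1 by rewrite inE.
rewrite (sE a aL) tpermD //; apply: contraTneq (aL) => e; rewrite -leqNgt.
  by move: e; rewrite -(sE a aL) => /perm_inj /injf ->.
by rewrite (injg _ _ LL aL' e).
Qed.

Lemma fcycle_exists (T : finType) (f : T -> T) (x : T) :
  exists2 y, fconnect f x y & fcycle f (fingraph.orbit f y).
Proof.
have /trajectP[j jlt ej] := looping_order f x.
exists (iter j f x); first exact: fconnect_iter.
apply/(orbitPcycle 3%N 0%N); exists ((fingraph.order f x - j).-1).
by rewrite -iterD prednK ?subn_gt0 // subnK ?(ltnW jlt) // ej.
Qed.

Definition circulation (V : nmodType) n (D : 'M[V]_n) :=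
  (forall i, \sum_j D i j = 0) /\ (forall j, \sum_i D i j = 0).

(** Tridiagonal support up to independent renumberings of rows and columns: the form in which a
    cycle can be slid into the band. *)
Definition narrow n (Z : 'M[int]_n) :=
  exists s t : 'S_n, forall i j, Z i j != 0 -> (s i <= (t j).+1)%N /\ (t j <= (s i).+1)%N.

(* The vertices of a cycle of length 2L, alternately rows and columns, are
   placed at positions 0, 1, ..., L-1, L-1, ..., 1, 0. *)
Definition ladder L m := if (m < L)%N then m else ((L.*2).-1 - m)%N.

Lemma cycle_narrow n L (r c : nat -> 'I_n) (Z : 'M[int]_n) : (0 < L)%N ->
  {in gtn L &, injective r} -> {in gtn L &, injective c} -> r L = r 0%N ->
  (forall i j, Z i j != 0 ->
     exists2 a, (a < L)%N & (i = r a \/ i = r a.+1) /\ j = c a) ->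
  narrow Z.
Proof.
move=> L_gt0 injr injc rL Zsupp.
have Ln : (L <= n)%N.
  have injr' : injective (fun a : 'I_L => r a).
    by move=> a b /injr e; apply/val_inj/e; rewrite inE ltn_ord.
  by have := leq_card _ injr'; rewrite !card_ord.
case: n => [|n] in r c Z injr injc rL Zsupp Ln *; first by case: (r 0%N).
have lad_lt a : (a < L.*2)%N -> (ladder L a < n.+1)%N.
  by rewrite /ladder; case: ifP; lia.
(* Two distinct positions share a ladder value only if they sum to 2L - 1, which is odd; so rows
   (even positions) get distinct values, and so do columns (odd positions). *)
have inord_lad (e : nat) : (e < 2)%N ->
    {in gtn L &, injective (fun a => inord (ladder L (a.*2 + e)) : 'I_n.+1)}.
  move=> e2 a b; rewrite !inE => aL bL /(congr1 val) /=.
  rewrite !inordK; try (apply: lad_lt; lia).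
  by rewrite /ladder; case: ifP; case: ifP; lia.
have [s sE] := perm_extends injr (inord_lad 0%N isT).
have [t tE] := perm_extends injc (inord_lad 1%N isT).
exists s, t => i j /Zsupp[a aL [ri ->]].
have {tE}-> := tE _ aL.
(* The row after [c a] sits at position 2a + 2, except that the last one is [r L = r 0], at position
   0; positions 2L - 1 and 0 both have ladder value 0. *)
have {sE ri} : (s i : nat) = ladder L a.*2 \/
    (s i : nat) = ladder L (if a.+1 == L then 0%N else a.+1.*2).
  case: ri => ->; first by left; rewrite sE // addn0 inordK // lad_lt; lia.
  right; case: eqP => [->|aL']; first by rewrite rL sE // addn0 inordK // lad_lt; lia.
  by rewrite sE ?addn0 ?inordK ?lad_lt; lia.
rewrite inordK; last by apply: lad_lt; lia.
by rewrite /ladder => -[] ->; repeat case: ifP; lia.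
Qed.

Lemma sum_neg_exists (R : realDomainType) (I : finType) (F : I -> R) i :
  \sum_i F i = 0 -> 0 < F i -> exists j, F j < 0.
Proof.
move=> F0 Fi; apply/existsP; apply: contraT; rewrite negb_exists => /forallP Fge0.
have := F0; rewrite (bigD1 i) //= => e.
have : 0 <= \sum_(j | j != i) F j.
  by apply: sumr_ge0 => j _; rewrite leNgt; apply: Fge0.
lra.
Qed.

Lemma sum_pos_exists (R : realDomainType) (I : finType) (F : I -> R) i :
  \sum_i F i = 0 -> F i < 0 -> exists j, 0 < F j.
Proof.
move=> F0 Fi; have [||j] := @sum_neg_exists _ _ (fun i => - F i) i.
- by rewrite sumrN F0 oppr0.
- by rewrite oppr_gt0.
by rewrite oppr_lt0; exists j.
Qed.

Definition conformal (R : realDomainType) n (D : 'M[R]_n) (Z : 'M[int]_n) :=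
  forall i j, (0 < Z i j -> 0 < D i j) /\ (Z i j < 0 -> D i j < 0).

(** From a row with a positive entry, go to the column of such an entry, then to a row where that
    column is negative; zero sums make both moves possible forever. This self-map of rows runs into
    a cycle, along which [Z] alternates +1 and -1. *)
Lemma conformal_cycle (R : realDomainType) n (D : 'M[R]_n) :
  circulation D -> D != 0 ->
  exists Z : 'M[int]_n, [/\ circulation Z, Z != 0, conformal D Z & narrow Z].
Proof.
move=> [Drow Dcol] D_neq0.
pose active i := [exists j, 0 < D i j].
have [i0 act0] : exists i, active i.
  have [i [j Dij]] : exists i, exists j, D i j != 0.
    apply: contrapT => nex; move/eqP: D_neq0; apply; apply/matrixP => i j.
    by rewrite mxE; apply: contrapT => /eqP Dij; apply: nex; exists i, j.
  exists i; apply/existsP; move: Dij; rewrite neq_lt => /orP[] Dij; last by exists j.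
  exact: sum_pos_exists (Drow i) Dij.
(* On active rows both picks succeed, so the default values never occur along the walk. *)
pose h i := odflt i [pick j | 0 < D i j].
pose g j := odflt j [pick i | D i j < 0].
have hP i : active i -> 0 < D i (h i).
  by move=> /existsP[j Dij]; rewrite /h; case: pickP => // /(_ j); rewrite Dij.
have gP i : active i -> D (g (h i)) (h i) < 0.
  move=> /hP Dih; have [i' Di'] := sum_neg_exists (Dcol (h i)) Dih.
  by rewrite {1}/g; case: pickP => // /(_ i'); rewrite Di'.
pose phi i := g (h i).
have phi_act i : active i -> active (phi i).
  by move=> /gP Di; apply/existsP/(sum_pos_exists (Drow _) Di).
have iter_act k i : active i -> active (iter k phi i).
  by move=> ai; elim: k => //= k; apply: phi_act.
have [y xy cy] := fcycle_exists phi i0.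
have acty : active y by rewrite -(iter_findex xy) iter_act.
pose L := fingraph.order phi y; pose r a := iter a phi y; pose c a := h (r a).
have L_gt0 : (0 < L)%N by exact: fingraph.order_gt0.
have rL : r L = r 0%N by have /(orbitPcycle 0%N 4%N) := cy.
have injr : {in gtn L &, injective r}.
  move=> a b; rewrite !inE => aL bL /eqP.
  rewrite /r -(nth_traject phi aL) -(nth_traject phi bL).
  by rewrite nth_uniq ?size_traject // ?fingraph.orbit_uniq // => /eqP.
(* Equal columns have equal successor rows under [g], and [phi] is injective on its cycle. *)
have injc : {in gtn L &, injective c}.
  move=> a b; rewrite !inE => aL bL /(congr1 g); rewrite -!/(phi _) => e.
  apply: injr; rewrite ?inE //.
  have /(orbitPcycle 0%N 5%N) inj := cy.
  by apply: inj => //; rewrite -fconnect_orbit; apply: fconnect_iter.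
pose Z : 'M[int]_n := \matrix_(i, j) \sum_(a < L)
  (((i == r a) && (j == c a))%:R - ((i == r a.+1) && (j == c a))%:R).
have actr a : active (r a) by apply: iter_act.
have Z_neq i j : Z i j != 0 ->
     exists2 a, (a < L)%N & (i = r a \/ i = r a.+1) /\ j = c a.
  move=> Zij; apply: contrapT => nex; move/eqP: Zij; apply.
  rewrite mxE big1 // => a _.
  case: (j =P c a) => [ja|_]; last by rewrite !andbF subrr.
  case: eqP => [ia|_]; first by case: nex; exists a => //; split=> //; left.
  case: eqP => [ia|_]; first by case: nex; exists a => //; split=> //; right.
  by rewrite subrr.
have Dpos a : 0 < D (r a) (c a) by apply: hP.
have Dneg a : D (r a.+1) (c a) < 0 by apply: gP.
(* No cancellation occurs: where [D] is not positive every term of [Z] is at most 0, and where it is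
   not negative every term is at least 0. *)
have conf : conformal D Z.
  move=> i j; split=> [Zij|Zij]; rewrite ltNge; apply/negP => Dij; move: Zij; apply/negP;
      rewrite -leNgt mxE; [apply: sumr_le0|apply: sumr_ge0] => a _.
    case: (altP (i =P r a)) => [e1|_] /=; last by rewrite sub0r oppr_le0.
    case: (altP (j =P c a)) => [e2|_] /=; last by rewrite andbF.
    by move: Dij; rewrite e1 e2 leNgt Dpos.
  case: (altP (i =P r a.+1)) => [e1|_] /=; last by rewrite subr0.
  case: (altP (j =P c a)) => [e2|_] /=; last by rewrite andbF.
  by move: Dij; rewrite e1 e2 leNgt Dneg.
exists Z; split => //.
- split=> [i|j].
    under eq_bigr do rewrite mxE.
    rewrite exchange_big /=.
    transitivity (\sum_(0 <= a < L) ((i == r a)%:R - (i == r a.+1)%:R : int)).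
      rewrite big_mkord; apply: eq_bigr => a _; rewrite (bigD1 (c a)) //= eqxx !andbT.
      by rewrite big1 ?addr0 // => j /negPf ->; rewrite !andbF subrr.
    under eq_bigr do rewrite -opprB.
    by rewrite sumrN telescope_sumr // rL subrr oppr0.
  under eq_bigr do rewrite mxE.
  rewrite exchange_big /= big1 // => a _; rewrite sumrB.
  rewrite (bigD1 (r a)) //= eqxx big1 => [|i /negPf->//].
  rewrite (bigD1 (r a.+1)) //= eqxx big1 => [|i /negPf->//].
  by rewrite subrr.
(* [D] is positive at this entry, so no -1 falls on it, while the term of index 0 contributes +1. *)
- have : 0 < Z (r 0%N) (c 0%N).
    rewrite mxE (bigD1 (Ordinal L_gt0)) //= !eqxx /=.
    have term_ge0 a : 0 <= (((r 0 == r a) && (c 0 == c a))%:R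
       - ((r 0 == r a.+1) && (c 0 == c a))%:R : int).
      case: (altP (r 0 =P r a.+1)) => [e1|_] /=; last by rewrite subr0.
      case: (altP (c 0 =P c a)) => [e2|_] /=; last by rewrite andbF.
      by have := Dneg a; rewrite -e1 -e2 ltNge ltW // Dpos.
    rewrite ltr_wpDr //; first by apply: sumr_ge0 => a _; apply: term_ge0.
    case: (altP (r 0 =P r 1)) => [e1|_] //=.
    by have := Dneg 0%N; rewrite -e1 ltNge ltW // Dpos.
  by apply: contraTneq => ->; rewrite mxE ltxx.
- exact: cycle_narrow L_gt0 injr injc rL Z_neq.
Qed.

Definition mxsupp (V : nmodType) n (D : 'M[V]_n) : {set 'I_n * 'I_n} :=
  [set ij | D ij.1 ij.2 != 0]%SET.

Lemma sum_other_neq0 (V : zmodType) (I : finType) (F : I -> V) i :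
  \sum_k F k = 0 -> F i != 0 -> exists2 j, j != i & F j != 0.
Proof.
move=> F0 Fi; apply: contrapT => nex; move/eqP: Fi; apply.
move: F0; rewrite (bigD1 i) //= big1 ?addr0 // => j ji.
by apply: contrapT => /eqP Fj; apply: nex; exists j.
Qed.

(** A nonzero entry has a nonzero companion in its row and one in its column, and the latter has a
    further companion in its own row. *)
Lemma circulation_card (V : zmodType) n (D : 'M[V]_n) :
  circulation D -> D != 0 -> (4 <= #|mxsupp D|)%N.
Proof.
move=> [Drow Dcol] D_neq0.
have [i [j Dij]] : exists i, exists j, D i j != 0.
  apply: contrapT => nex; move/eqP: D_neq0; apply; apply/matrixP => i j.
  by rewrite mxE; apply: contrapT => /eqP Dij; apply: nex; exists i, j.
have [j' j'j Dij'] := sum_other_neq0 (Drow i) Dij.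
have [i' i'i Di'j] := sum_other_neq0 (Dcol j) Dij.
have [j'' j''j Di'j''] := sum_other_neq0 (Drow i') Di'j.
have uniq4 : uniq [:: (i, j); (i, j'); (i', j); (i', j'')].
  rewrite /= !inE !xpair_eqE !eqxx /= ![i == i']eq_sym (negPf i'i) /= !orbF.
  by rewrite ![j == _]eq_sym j'j j''j.
rewrite -[4%N]/(size [:: (i, j); (i, j'); (i', j); (i', j'')]) cardE.
apply: uniq_leq_size => // z; rewrite mem_enum !inE.
by move=> /or4P[] /eqP ->.
Qed.

Lemma circulationB (R : pzRingType) n (D E : 'M[R]_n) (a : R) :
  circulation D -> circulation E -> circulation (D - a *: E).
Proof.
move=> [D1 D2] [E1 E2]; split=> k; under eq_bigr do rewrite !mxE.
  by rewrite sumrB -mulr_sumr D1 E1 mulr0 subr0.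
by rewrite sumrB -mulr_sumr D2 E2 mulr0 subr0.
Qed.

Lemma circulation_intr (R : pzRingType) n (Z : 'M[int]_n) :
  circulation Z -> circulation (map_mx intr Z : 'M[R]_n).
Proof.
by move=> [Z1 Z2]; split=> k; under eq_bigr do rewrite mxE;
  rewrite -rmorph_sum /= (Z1, Z2) mulr0z.
Qed.

Definition conformal_terms (R : realDomainType) n (D : 'M[R]_n)
    (s : seq (R * 'M[int]_n)) :=
  D = \sum_(z <- s) z.1 *: map_mx intr z.2 /\
  forall z, z \in s ->
    [/\ 0 < z.1, circulation z.2, narrow z.2 & conformal D z.2].

(* Removing a conformal cycle with the largest possible weight kills an entry
   of D, and the last cycle removed kills at least four. *)
Lemma conformal_decomposition (R : realFieldType) n (D : 'M[R]_n) :
  circulation D ->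
  exists2 s, conformal_terms D s & (size s <= #|mxsupp D| - 3)%N.
Proof.
have [m] := ubnP #|mxsupp D|; elim: m => // m IH in D *; rewrite ltnS => Dm Dcirc.
have [->|D_neq0] := eqVneq D 0.
  by exists [::] => //; split=> //; rewrite big_nil.
have [Z [Zcirc Z_neq0 DZ Znar]] := conformal_cycle Dcirc D_neq0.
have [k0 Zk0] : exists k, Z k.1 k.2 != 0.
  have : (0 < #|mxsupp Z|)%N by apply: leq_trans (circulation_card Zcirc Z_neq0).
  by case/card_gt0P => k; rewrite inE; exists k.
(* The minimal ratio over the support of [Z] is the largest weight whose removal flips no sign of
   [D]; the minimising entry becomes 0. *)
have /= := @Order.TotalTheory.arg_minP _ _ _ k0 (fun k => Z k.1 k.2 != 0)
  (fun k => D k.1 k.2 / (Z k.1 k.2)%:~R) Zk0.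
set k1 := Order.arg_min _ _ _; case: k1 / => k1 Zk1 k1min.
set th := D k1.1 k1.2 / (Z k1.1 k1.2)%:~R in k1min.
have th_gt0 : 0 < th.
  have [Dp Dn] := DZ k1.1 k1.2.
  move: Zk1; rewrite neq_lt => /orP[] Zk1.
    by rewrite ltr_ndivlMr ?ltrz0 // mul0r Dn.
  by rewrite divr_gt0 ?ltr0z ?Dp.
pose D' := D - th *: map_mx intr Z.
have D'circ : circulation D' by apply/circulationB/circulation_intr.
have D'0 i j : D i j = 0 -> D' i j = 0.
  move=> Dij; have [Dp Dn] := DZ i j.
  have Zij : Z i j = 0.
    by case: (ltgtP (Z i j) 0) => // [/Dn|/Dp]; rewrite Dij ltxx.
  by rewrite !mxE Dij Zij mulr0 subr0.
have D'D i j : (0 < D' i j -> 0 < D i j) /\ (D' i j < 0 -> D i j < 0).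
  rewrite !mxE; have [Dp Dn] := DZ i j.
  have := k1min (i, j) => /= thmin.
  case: (ltgtP (Z i j) 0) => [Zij|Zij|Zij].
  - have Dij := Dn Zij; move: thmin; rewrite lt_eqF // => /(_ isT).
    rewrite ler_ndivlMr ?ltrz0 //; lra.
  - have Dij := Dp Zij; move: thmin; rewrite gt_eqF // => /(_ isT).
    rewrite ler_pdivlMr ?ltr0z //; lra.
  - by rewrite Zij mulr0 subr0.
have D'k1 : D' k1.1 k1.2 = 0.
  by rewrite !mxE divfK ?subrr // intr_eq0.
have Dk1 : D k1.1 k1.2 != 0.
  by apply: contraTneq th_gt0 => e; rewrite /th e mul0r ltxx.
have supp_lt : (#|mxsupp D'| < #|mxsupp D|)%N.
  apply: proper_card; apply/properP; split.
    apply/fintype.subsetP => -[i j]; rewrite !inE /=.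
    by apply: contraNneq => /D'0 ->.
  by exists k1; rewrite inE // D'k1 eqxx.
have D4 := circulation_card Dcirc D_neq0.
have [D'E|D'_neq0] := eqVneq D' 0.
  exists [:: (th, Z)]; last by rewrite /= subn_gt0.
  split; first by rewrite big_seq1; apply/eqP; rewrite -subr_eq0 -/D' D'E.
  by move=> z; rewrite inE => /eqP ->.
have [||s [sE sP] size_s] := IH D' => //; first exact: leq_trans Dm.
(* As [D'] has at least four nonzero entries, subtracting 3 does not truncate, and the killed entry
   pays for the new term. *)
exists ((th, Z) :: s); last first.
  move: size_s supp_lt (circulation_card D'circ D'_neq0) => /=.
  by move: #|_| #|_| (size s) => a b c; lia.
split; first by rewrite big_cons -sE /= addrC subrK.
move=> z; rewrite inE => /predU1P[->//|/sP[? ? ? conf]]; split=> // i j.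
have [D1 D2] := D'D i j; have [C1 C2] := conf i j.
by split=> [/C1/D1|/C2/D2].
Qed.

(** * Embedding cycles in the band *)

(** The band consists of the entries with row minus column in [0, p - 1] modulo n. Here the
    difference is a - b + v + 1, which lies in [v, v + 2], and v + 2 is at most p - 1. *)
Lemma in_band_modn n p a b u v : (3 <= p <= n)%N -> (a < n)%N -> (b < n)%N ->
  (u < n)%N -> (v < p - 2)%N -> (a <= b.+1)%N -> (b <= a.+1)%N ->
  in_band n p ((a + (u + v.+1)) %% n).+1 ((b + u) %% n).+1.
Proof.
move=> pn an bn un vp ab ba.
have modE m : (m < 3 * n)%N ->
    [\/ (m %% n = m /\ m < n), (m %% n = m - n /\ n <= m < 2 * n)
      | (m %% n = m - 2 * n /\ 2 * n <= m)]%N.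
  move=> mn; case: (ltnP m n) => [m1|m1]; first by constructor 1; rewrite modn_small.
  case: (ltnP m (2 * n)) => [m2|m2].
    constructor 2; split=> //; rewrite -(modn_small (_ : m - n < n)%N); last by lia.
    by rewrite -[in LHS](subnK m1) modnDr.
  constructor 3; split=> //; rewrite -(modn_small (_ : m - 2 * n < n)%N); last by lia.
  by rewrite -[in LHS](subnK m2) addnC modnMDl.
rewrite /in_band.
have h1 : (a + (u + v.+1) < 3 * n)%N by lia.
have h2 : (b + u < 3 * n)%N by lia.
by case: (modE _ h1) => -[-> k1]; case: (modE _ h2) => -[-> k2]; lia.
Qed.

Definition ord_rot n k (i : 'I_n) : 'I_n :=
  Ordinal (ltn_pmod (i + k) (leq_ltn_trans (leq0n i) (ltn_ord i))).

Lemma ord_rot_inj n k : injective (@ord_rot n k).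
Proof.
move=> i j /(congr1 val) /= /eqP; rewrite eqn_modDr => /eqP ij.
by apply/val_inj; rewrite /= -(modn_small (ltn_ord i)) -(modn_small (ltn_ord j)).
Qed.

Definition band_perms n p (Z : 'M[int]_n) : {set 'S_n * 'S_n} :=
  [set st : 'S_n * 'S_n | [forall i, forall j, (Z i j != 0) ==>
     in_band n p (st.1 i).+1 (st.2 j).+1]]%SET.

(* A narrow support is moved inside the band by shifting the columns
   cyclically by u and the rows by u + v + 1, for u < n and v < p - 2. *)
Lemma card_band_perms n p (Z : 'M[int]_n) : (3 <= p <= n)%N ->
  narrow Z -> (n * (p - 2) <= #|band_perms p Z|)%N.
Proof.
move=> pn [s [t st]].
pose rot k : 'S_n := perm (@ord_rot_inj n k).
pose f (uv : 'I_n * 'I_(p - 2)) := (s * rot (uv.1 + uv.2.+1)%N, t * rot uv.1)%g.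
have n_gt0 : (0 < n)%N by lia.
have injf : injective f.
  (* The image of index 0 suffices: the column permutation determines [u], then the row permutation
     determines [v]. *)
  move=> [u v] [u' v'] [/permP /(_ (Ordinal n_gt0)) es /permP /(_ (Ordinal n_gt0))].
  move: es; rewrite !permM !permE => /(congr1 val) /= es /(congr1 val) /= /eqP.
  rewrite eqn_modDl !modn_small // => /eqP /val_inj uu; rewrite {}uu in es *.
  move/eqP: es; rewrite !eqn_modDl !modn_small; last 2 first.
  - by have := ltn_ord v'; lia.
  - by have := ltn_ord v; lia.
  by move=> /eqP [] /val_inj ->.
rewrite -[n in (n * _)%N]card_ord -[(p - 2)%N]card_ord -card_prod -(card_imset _ injf).
apply/subset_leq_card/fintype.subsetP => _ /imsetP[[u v] _ ->].
rewrite inE; apply/forallP => i; apply/forallP => j; apply/implyP => /st[si tj].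
by rewrite !permM !permE /=; apply: in_band_modn.
Qed.

(** * Directions of the transport program *)

Lemma index_allpairs (S T : eqType) (s : seq S) (t : seq T) x y :
  x \in s -> y \in t ->
  index (x, y) [seq (x', y') | x' <- s, y' <- t] = (index x s * size t + index y t)%N.
Proof.
move=> + yt; elim: s => //= x' s IH; rewrite inE index_cat.
have [->|xx'] := eqVneq x x'.
  rewrite /= mul0n add0n => _.
  rewrite map_f ?index_map // => ? ? [] //.
move=> /= /IH ->.
case: ifP => [/mapP[z _ []]|_]; first by move=> e; rewrite e eqxx in xx'.
by rewrite size_map mulSn addnA.
Qed.

(** Links the abstract enumeration behind [mxvec] to the quotients and remainders that define
    [otA]. *)
Lemma mxvec_index_val m n (i : 'I_m) (j : 'I_n) :
  mxvec_index i j = (i * n + j)%N :> nat.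
Proof.
rewrite /mxvec_index /= /enum_rank enum_rank_in.unlock insubdK; last first.
  by rewrite unfold_in /= cardE index_mem mem_enum.
have -> : enum {: 'I_m * 'I_n} = [seq (i', j') | i' <- enum 'I_m, j' <- enum 'I_n].
  by rewrite enumT unlock.
rewrite index_allpairs ?mem_enum //.
by rewrite !index_enum_ord size_enum_ord.
Qed.

(** The column index comes first because columns are stacked. *)
Definition unvec (R : realType) n (d : 'cV[R]_(n * n)) : 'M[R]_n :=
  \matrix_(i, j) d (mxvec_index j i) 0.

Lemma unvecK (R : realType) n : cancel (@unvec R n) (@vec R n).
Proof.
move=> d; apply/colP => l; rewrite /vec mxE.
by case/mxvec_indexP: l => i j; rewrite mxvecE !mxE.
Qed.

Lemma vecE (R : realType) n (X : 'M[R]_n) i j : vec X (mxvec_index j i) 0 = X i j.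
Proof. by rewrite /vec mxE mxvecE mxE. Qed.

Lemma vecK (R : realType) n : cancel (@vec R n) (@unvec R n).
Proof. by move=> X; apply/matrixP => i j; rewrite mxE vecE. Qed.

Lemma sum_mxvec_index (V : nmodType) m n (F : 'I_(m * n) -> V) :
  \sum_l F l = \sum_i \sum_j F (mxvec_index i j).
Proof.
rewrite (reindex _ (curry_mxvec_bij m n)) /=.
by rewrite (pair_bigA _ (fun i j => F (mxvec_index i j))); apply: eq_bigr => -[].
Qed.

Lemma otA_row_sum (R : realType) n (x : 'cV[R]_(n * n)) i :
  (otA R n *m x) (lshift n i) 0 = \sum_j unvec x i j.
Proof.
rewrite mxE sum_mxvec_index; apply: eq_bigr => j _.
rewrite (bigD1 i) //= big1 ?addr0 => [|i' ne].
  by rewrite mxE (unsplitK (inl i)) !mxE mxvec_index_val modnMDl modn_small ?eqxx ?mul1r.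
rewrite mxE (unsplitK (inl i)) !mxE mxvec_index_val modnMDl modn_small //.
by rewrite -[(i' : nat) == i]/(i' == i) (negPf ne) mul0r.
Qed.

Lemma otA_col_sum (R : realType) n (x : 'cV[R]_(n * n)) j :
  (otA R n *m x) (rshift n j) 0 = \sum_i unvec x i j.
Proof.
have div_val (i j' : 'I_n) : ((mxvec_index j' i : nat) %/ n)%N = j'.
  by rewrite mxvec_index_val divnMDl ?divn_small ?addn0 // (leq_ltn_trans _ (ltn_ord i)).
rewrite mxE sum_mxvec_index (bigD1 j) //= [X in _ + X]big1 ?addr0 => [|j' ne].
  by apply: eq_bigr => i _; rewrite mxE (unsplitK (inr j)) !mxE div_val eqxx mul1r.
apply: big1 => i _; rewrite mxE (unsplitK (inr j)) !mxE div_val.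
by rewrite -[(j' : nat) == j]/(j' == j) (negPf ne) mul0r.
Qed.

Lemma otA_circulation (R : realType) n (d : 'cV[R]_(n * n)) :
  otA R n *m d = 0 <-> circulation (unvec d).
Proof.
split=> [d0|[d1 d2]].
  by split=> [i|j]; rewrite -?otA_row_sum -?otA_col_sum d0 mxE.
apply/colP => l; rewrite [RHS]mxE.
by case: (split_ordP l) => [i|j] ->; rewrite ?otA_row_sum ?otA_col_sum.
Qed.

Lemma mem_band_select (R : realType) n p (s t : 'S_n) i j :
  (mxvec_index j i \in band_select R n p s t) = in_band n p (s i).+1 (t j).+1.
Proof.
by rewrite inE vecE !mxE; case: in_band; rewrite ?oner_eq0 // eqxx.
Qed.

Lemma costD (R : realType) N (c x y : 'cV[R]_N) : cost c (x + y) = cost c x + cost c y.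
Proof. by rewrite /cost mulmxDr mxE. Qed.

Lemma costZ (R : realType) N (c x : 'cV[R]_N) a : cost c (a *: x) = a * cost c x.
Proof. by rewrite /cost -scalemxAr mxE. Qed.

Lemma costB (R : realType) N (c x y : 'cV[R]_N) : cost c (x - y) = cost c x - cost c y.
Proof. by rewrite costD -scaleN1r costZ mulN1r. Qed.

Lemma cost_sum (R : realType) N (c : 'cV[R]_N) I (s : seq I) (F : I -> 'cV[R]_N) :
  cost c (\sum_(z <- s) F z) = \sum_(z <- s) cost c (F z).
Proof. by rewrite /cost mulmx_sumr summxE. Qed.

Lemma vec_sum (R : realType) n I (s : seq I) (F : I -> 'M[R]_n) :
  vec (\sum_(z <- s) F z) = \sum_(z <- s) vec (F z).
Proof.
apply/colP => l; case/mxvec_indexP: l => j i.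
by rewrite vecE !summxE; apply: eq_bigr => z _; rewrite vecE.
Qed.

Lemma vecZ (R : realType) n (X : 'M[R]_n) a : vec (a *: X) = a *: vec X.
Proof.
apply/colP => l; case/mxvec_indexP: l => j i.
by rewrite vecE mxE [RHS]mxE vecE.
Qed.

(** Since [x + d] is again feasible. This lower bound makes the infimum in [qval] meaningful. *)
Lemma dir_cost_ge (R : realType) n b (c xopt x d : 'cV[R]_(n * n)) I :
  ot_optimal b c xopt -> ot_feasible b x -> dir_feasible x I d ->
  cost c xopt - cost c x <= cost c d.
Proof.
move=> [_ opt] [xb _] [xd Ad _]; rewrite lerBlDl -costD; apply: opt.
by split; rewrite ?mulmxDr ?Ad ?addr0.
Qed.

Lemma dir_feasible0 (R : realType) n (x : 'cV[R]_(n * n)) I :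
  nonneg x -> dir_feasible x I 0.
Proof. by move=> x0; split=> [|| l _]; rewrite ?addr0 ?mulmx0 ?mxE. Qed.

(** * Optimal values of the restricted programs *)

Section QVal.
Variables (R : realType) (n : nat) (b : 'cV[R]_(n + n)) (c xopt : 'cV[R]_(n * n)).
Hypothesis opt : ot_optimal b c xopt.
Implicit Types (x d : 'cV[R]_(n * n)) (I : {set 'I_(n * n)}).

Lemma qval_le x I d : ot_feasible b x -> dir_feasible x I d -> qval c x I <= cost c d.
Proof.
move=> xb xd; apply: ge_inf; last by exists d.
by exists (cost c xopt - cost c x) => _ [d' xd' <-]; apply: dir_cost_ge opt xb xd'.
Qed.

Lemma qval_ge x I : ot_feasible b x -> cost c xopt - cost c x <= qval c x I.
Proof.
move=> xb; apply: lb_le_inf.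
  by exists (cost c 0), 0 => //; apply: dir_feasible0; case: xb.
by move=> _ [d' xd' <-]; apply: dir_cost_ge opt xb xd'.
Qed.

Lemma qval_le0 x I : ot_feasible b x -> qval c x I <= 0.
Proof.
move=> xb; have -> : 0 = cost c 0 by rewrite /cost mulmx0 mxE.
by apply: (qval_le xb); apply: dir_feasible0; case: xb.
Qed.

Lemma dir_feasibleB x y : ot_feasible b x -> ot_feasible b y ->
  dir_feasible x [set: 'I_(n * n)]%SET (y - x).
Proof.
move=> [xb x0] [yb y0]; split.
- by rewrite addrC subrK.
- by rewrite mulmxBr xb yb subrr.
- by move=> l; rewrite inE.
Qed.

(** The direction [xopt - x] attains the lower bound. The unrestricted value being minus the
    optimality gap, the Gauss-Southwell inequality becomes a contraction of the gap. *)
Lemma qval_setT x : ot_feasible b x ->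
  qval c x [set: 'I_(n * n)]%SET = cost c xopt - cost c x.
Proof.
move=> xb; apply/eqP; rewrite eq_le qval_ge // andbT -costB.
by apply/(qval_le xb)/dir_feasibleB => //; case: opt.
Qed.

Lemma qval_lt x I a : ot_feasible b x -> qval c x I < a ->
  exists2 d, dir_feasible x I d & cost c d < a.
Proof.
move=> xb /inf_lt[|_ [d xd <-] da]; last by exists d.
by exists (cost c 0), 0 => //; apply: dir_feasible0; case: xb.
Qed.

End QVal.

Lemma qval_Dopt (R : realType) n (c x d : 'cV[R]_(n * n)) I :
  Dopt c x I d -> qval c x I = cost c d.
Proof.
move=> [xd dmin]; apply/eqP; rewrite eq_le; apply/andP; split.
  apply: ge_inf; last by exists d.
  by exists (cost c d) => _ [d' /dmin ? <-].
by apply: lb_le_inf; [exists (cost c d), d | move=> _ [d' /dmin ? <-]].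
Qed.

(** * Cycles as feasible directions *)

Lemma conformal_family (R : realFieldType) n (D : 'M[R]_n) : circulation D ->
  exists m (lam : 'I_m -> R) (Z : 'I_m -> 'M[int]_n),
    [/\ (m <= n * n - 3)%N, D = \sum_k lam k *: map_mx intr (Z k) &
        forall k, [/\ 0 < lam k, circulation (Z k), narrow (Z k) & conformal D (Z k)]].
Proof.
move=> Dcirc; have [s [DE sP] size_s] := conformal_decomposition Dcirc.
exists (size s), (fun k => (tnth (in_tuple s) k).1), (fun k => (tnth (in_tuple s) k).2).
split.
- apply: leq_trans size_s _; apply: leq_sub2r.
  by rewrite (leq_trans (max_card _)) // card_prod card_ord.
- by rewrite {1}DE big_tnth.
- by move=> k; apply: sP; rewrite -[X in _ \in X]/(tval (in_tuple s)) mem_tnth.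
Qed.

(** By conformality, where [d] is negative the reduced combination is no smaller than [d], and
    elsewhere it is nonnegative. This serves both to isolate one cycle and to round the weights. *)
Lemma dir_feasible_partial (R : realType) n (x d : 'cV[R]_(n * n)) I m
    (lam mu : 'I_m -> R) (Z : 'I_m -> 'M[int]_n) :
  nonneg x -> dir_feasible x I d -> unvec d = \sum_k lam k *: map_mx intr (Z k) ->
  (forall k, [/\ 0 <= mu k <= lam k, circulation (Z k) & conformal (unvec d) (Z k)]) ->
  dir_feasible x I (\sum_k mu k *: vec (map_mx intr (Z k))).
Proof.
move=> x_ge0 [xd _ dI] dE mulam; split.
- move=> l; case/mxvec_indexP: l => j i; have := xd (mxvec_index j i); rewrite mxE.
  have -> : d (mxvec_index j i) 0 = unvec d i j by rewrite mxE.
  move=> xdij; rewrite mxE summxE.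
  under eq_bigr do rewrite mxE vecE mxE.
  have [Dij|Dij] := ltP (unvec d i j) 0.
    apply: le_trans xdij _; rewrite lerD2l {1}dE summxE; apply: ler_sum => k _.
    rewrite mxE [map_mx _ _ _ _]mxE.
    have [/andP[mu0 mul] _ conf] := mulam k.
    apply: ler_wnM2r => //; rewrite lerz0 leNgt; apply/negP => /(conf i j).1.
    by rewrite ltNge ltW.
  rewrite addr_ge0 // sumr_ge0 // => k _.
  have [/andP[mu0 mul] _ conf] := mulam k.
  rewrite mulr_ge0 // ler0z leNgt; apply/negP => /(conf i j).2.
  by rewrite ltNge Dij.
- rewrite mulmx_sumr big1 // => k _; rewrite -scalemxAr.
  have [_ /(circulation_intr R) Zcirc _] := mulam k.
  by rewrite (otA_circulation _).2 ?scaler0 // vecK.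
- move=> l lI; case/mxvec_indexP: l lI => j i lI; rewrite summxE big1 // => k _.
  rewrite mxE vecE mxE; have [_ _ conf] := mulam k.
  have [C1 C2] := conf i j; have := dI _ lI.
  have -> : d (mxvec_index j i) 0 = unvec d i j by rewrite mxE.
  move=> Dij; case: (ltgtP (Z k i j) 0) => [/C2|/C1|->]; rewrite ?Dij ?ltxx //.
  by rewrite mulr0.
Qed.

Lemma cost_family (R : realType) n (c d : 'cV[R]_(n * n)) m
    (lam : 'I_m -> R) (Z : 'I_m -> 'M[int]_n) :
  unvec d = \sum_k lam k *: map_mx intr (Z k) ->
  cost c d = \sum_k lam k * cost c (vec (map_mx intr (Z k))).
Proof.
move=> dE; rewrite -(unvecK d) dE vec_sum cost_sum.
by apply: eq_bigr => k _; rewrite vecZ costZ.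
Qed.

Lemma narrow_direction (R : realType) n (c x d : 'cV[R]_(n * n)) I : (2 <= n)%N ->
  nonneg x -> dir_feasible x I d -> cost c d < 0 ->
  exists Z e, [/\ narrow Z, dir_feasible x I e,
    forall i j, Z i j = 0 -> e (mxvec_index j i) 0 = 0 &
    cost c e <= cost c d / (n%:R ^+ 2 - 3)].
Proof.
move=> n_ge2 x_ge0 xd cd_lt0; have [_ Ad _] := xd.
have [m [lam [Z [mn dE ZP]]]] := conformal_family ((otA_circulation d).1 Ad).
have cdE := cost_family c dE.
set K : R := n%:R ^+ 2 - 3.
have nn : (4 <= n * n)%N by rewrite (@leq_mul 2 2).
have KE : K = (n * n - 3)%:R by rewrite natrB ?natrM //; lia.
have K_gt0 : 0 < K by rewrite KE ltr0n; lia.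
(* Averaging: otherwise the at most [K] terms would sum to more than the negative number
   [cost c d]. *)
have [k kP] : exists k, lam k * cost c (vec (map_mx intr (Z k))) <= cost c d / K.
  apply: contrapT => nex.
  have gt_all k : cost c d / K < lam k * cost c (vec (map_mx intr (Z k))).
    by rewrite ltNge; apply/negP => kle; apply: nex; exists k.
  case: m lam Z mn {dE ZP nex} cdE gt_all => [|m] lam Z mn cdE gt_all.
    by move: cd_lt0; rewrite cdE big_ord0 ltxx.
  have : \sum_(k < m.+1) cost c d / K < cost c d.
    rewrite [ltRHS]cdE; apply: ltr_sum => //.
    by apply/hasP; exists ord0; rewrite ?mem_index_enum.
  rewrite sumr_const card_ord -[_ *+ _]mulr_natr mulrAC -mulrA.
  rewrite gtr_nMr //.
  rewrite ltr_pdivlMr // mul1r KE ltr_nat; lia.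
exists (Z k), (lam k *: vec (map_mx intr (Z k))); split.
- by case: (ZP k).
(* The reduced weights are [lam k] at [k] and 0 elsewhere. *)
- have := @dir_feasible_partial _ _ x d I _ lam (fun k' => lam k' *+ (k' == k)) Z x_ge0 xd dE.
  rewrite (bigD1 k) //= eqxx mulr1n big1 ?addr0 => [|k' /negPf ->]; last by rewrite scale0r.
  apply => k'; have [lam0 Zc _ conf] := ZP k'; split=> //.
  by case: (k' == k); rewrite ?mulr1n ?mulr0n lexx ltW.
- by move=> i j Zij; rewrite mxE vecE mxE Zij mulr0.
- by rewrite costZ.
Qed.

(** All the values are at most 0, so pairs outside [band_perms p Z] may be dropped; each remaining
    pair admits the cheap cycle [e], and there are at least n(p - 2) of them. *)
Lemma sum_qval_le (R : realType) n p b (c xopt x : 'cV[R]_(n * n)) :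
  (3 <= p <= n)%N -> ot_optimal b c xopt -> ot_feasible b x ->
  \sum_(st : 'S_n * 'S_n) qval c x (band_select R n p st.1 st.2) <=
  n%:R * (p%:R - 2) / (n%:R ^+ 2 - 3) * qval c x [set: 'I_(n * n)]%SET.
Proof.
move=> pn opt xb; have [bopt _] := opt; have [_ x_ge0] := xb.
have sum_le0 (A : {set 'S_n * 'S_n}) :
    \sum_(st | st \notin A) qval c x (band_select R n p st.1 st.2) <= 0.
  by apply: sumr_le0 => st _; apply: (qval_le0 opt).
rewrite (qval_setT opt xb) -costB.
have xd := dir_feasibleB xb bopt.
have : cost c (xopt - x) <= 0.
  by rewrite costB subr_le0; apply: (proj2 opt).
rewrite le_eqVlt => /predU1P[->|cd_lt0].
  by rewrite mulr0; have := sum_le0 finset.set0; under eq_bigl do rewrite inE.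
have [|Z [e [Znar xe Ze ce]]] := narrow_direction _ x_ge0 xd cd_lt0; first by lia.
rewrite (bigID (mem (band_perms p Z))) /=.
apply: le_trans (lerD _ (sum_le0 _)) _; first exact: lexx.
rewrite addr0.
have q_le st : st \in band_perms p Z ->
    qval c x (band_select R n p st.1 st.2) <= cost c (xopt - x) / (n%:R ^+ 2 - 3).
  rewrite inE => /forallP stZ; apply: le_trans ce; apply: (qval_le opt xb).
  have [x1 x2 _] := xe; split=> // l; case/mxvec_indexP: l => j i.
  rewrite mem_band_select => nst; apply: Ze.
  by apply: contraNeq nst => Zij; have /forallP /(_ j) /implyP -> := stZ i.
apply: le_trans (ler_sum _ q_le) _.
rewrite sumr_const -[leLHS]mulr_natl [leRHS]mulrAC -[leRHS]mulrA.
have q_lt0 : cost c (xopt - x) / (n%:R ^+ 2 - 3) <= 0.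
  rewrite ler_pdivrMr ?mul0r ?ltW //.
  have -> : (n%:R ^+ 2 - 3 : R) = (n * n - 3)%:R by rewrite natrB ?natrM //; nia.
  by rewrite ltr0n; nia.
apply: ler_wnM2r => //.
have -> : n%:R * (p%:R - 2) = (n * (p - 2))%:R :> R by rewrite natrM natrB //; lia.
by rewrite ler_nat; apply: card_band_perms.
Qed.

(** * Boundedness of the cost and measurability of the optimal value *)

Lemma feasible_cost_bound (R : realType) n (b : 'cV[R]_(n + n)) (c x : 'cV[R]_(n * n)) :
  ot_feasible b x -> `|cost c x| <= (\sum_l `|c l 0|) * \sum_l `|b l 0|.
Proof.
move=> [xb x0]; rewrite /cost mxE mulr_suml (le_trans (ler_norm_sum _ _ _)) //.
apply: ler_sum => l _; rewrite mxE normrM ler_wpM2l //.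
rewrite ger0_norm //; case/mxvec_indexP: l => j i.
have := otA_row_sum x i; rewrite xb => bE.
(* A nonnegative entry is at most its row sum, which is an entry of [b]. *)
apply: (@le_trans _ _ `|b (lshift n i) 0|).
  rewrite bE; apply: le_trans (ler_norm _).
  by rewrite (bigD1 j) //= mxE lerDl; apply: sumr_ge0 => k _; rewrite mxE.
by rewrite (bigD1 (lshift n i)) //= lerDl; apply: sumr_ge0.
Qed.

(** Rational directions with a common denominator, coded by a countable type; the successor keeps
    the denominator nonzero. *)
Definition rat_dir (R : realType) n (z : nat * 'M[int]_n) : 'cV[R]_(n * n) :=
  z.1.+1%:R^-1 *: vec (map_mx intr z.2).

(* Rounding down the weights of a conformal decomposition keeps a direction
   feasible and makes it rational. *)
Lemma qval_lt_rat_dir (R : realType) n (b : 'cV[R]_(n + n)) (c xopt x : 'cV[R]_(n * n)) I a :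
  ot_optimal b c xopt -> ot_feasible b x ->
  qval c x I < a <->
  exists z, dir_feasible x I (rat_dir R z) /\ cost c (rat_dir R z) < a.
Proof.
move=> opt xb; split=> [|[z [xz za]]]; last exact: le_lt_trans (qval_le opt xb xz) za.
move=> /(qval_lt xb)[d xd da]; have [_ Ad _] := xd.
have [m [lam [Z [_ dE ZP]]]] := conformal_family ((otA_circulation d).1 Ad).
pose cZ k := cost c (vec (map_mx intr (Z k))).
pose S := \sum_k `|cZ k|.
(* Rounding to multiples of 1/(M + 1) changes the cost by at most S/(M + 1), which this choice makes
   smaller than the slack [a - cost c d]. *)
pose M := Num.bound (S / (a - cost c d)).
have ad_gt0 : 0 < a - cost c d by rewrite subr_gt0.
have S_ge0 : 0 <= S by apply: sumr_ge0.
have M1_gt0 : 0 < M.+1%:R :> R by rewrite ltr0n.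
have SM : S / M.+1%:R < a - cost c d.
  rewrite ltr_pdivrMr // mulrC -ltr_pdivrMr //.
  apply: (lt_trans (archi_boundP _)); first by rewrite divr_ge0 // ltW.
  by rewrite ltr_nat.
pose f k := Num.floor (M.+1%:R * lam k).
pose mu k : R := (f k)%:~R / M.+1%:R.
have mu_bounds k : [/\ 0 <= mu k, mu k <= lam k & lam k <= mu k + M.+1%:R^-1].
  have [lam_gt0 _ _ _] := ZP k.
  split.
  - rewrite divr_ge0 ?ler0z ?floor_ge0 ?mulr_ge0 //; exact: ltW.
  - by rewrite ler_pdivrMr // mulrC floor_le.
  - rewrite -[X in _ + X]mul1r -mulrDl ler_pdivlMr // mulrC.
    by have := ltW (floorD1_gt (M.+1%:R * lam k)); rewrite rmorphD.
have ratE : rat_dir R (M, \sum_k f k *: Z k) = \sum_k mu k *: vec (map_mx intr (Z k)).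
  rewrite /rat_dir /=.
  have -> : map_mx intr (\sum_k f k *: Z k) =
      \sum_k (f k)%:~R *: map_mx intr (Z k) :> 'M[R]_n.
    rewrite raddf_sum /=; apply: eq_bigr => k _.
    by apply/matrixP => i j; rewrite !mxE intrM.
  rewrite vec_sum scaler_sumr; apply: eq_bigr => k _.
  by rewrite vecZ scalerA mulrC.
exists (M, \sum_k f k *: Z k); rewrite ratE; split.
  apply: (dir_feasible_partial _ xd dE) => [|k]; first by case: xb.
  by have [mu1 mu2 _] := mu_bounds k; have [_ ? _ ?] := ZP k; split=> //; apply/andP.
apply: le_lt_trans (_ : cost c d + S / M.+1%:R < a); last by rewrite -ltrBrDl.
rewrite (cost_family c dE) cost_sum mulr_suml -big_split /=.
apply: ler_sum => k _; rewrite costZ -/(cZ k) -lerBlDl -mulrBl.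
have [_ mu1 mu2] := mu_bounds k.
apply: le_trans (ler_norm _) _; rewrite normrM mulrC ler_wpM2l //.
by rewrite distrC ger0_norm ?subr_ge0 // lerBlDl.
Qed.

(** The domain is an arbitrary measurable type so that the sigma-algebra can be that of the
    history. *)
Lemma measurable_qval (R : realType) n (b : 'cV[R]_(n + n)) (c xopt : 'cV[R]_(n * n)) I
    (disp : measure_display) (U : measurableType disp) (X : U -> 'cV[R]_(n * n)) :
  ot_optimal b c xopt -> (forall w, ot_feasible b (X w)) ->
  (forall l, measurable_fun setT (fun w => X w l 0)) ->
  measurable_fun setT (fun w => qval c (X w) I).
Proof.
move=> opt Xb mX mT; apply: (measurability _ (RGenInftyO.measurableE R)) => //.
move=> _ [_ [a ->] <-]; rewrite setTI.
pose F z : set U := [set w | dir_feasible (X w) I (rat_dir R z) /\ cost c (rat_dir R z) < a].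
rewrite (_ : _ @^-1` _ = \bigcup_z F z); last first.
  apply/seteqP; split=> w /=; rewrite in_itv /=.
    by move=> /(qval_lt_rat_dir _ _ opt (Xb w))[z Fz]; exists z.
  by move=> [z _ Fz]; apply/(qval_lt_rat_dir _ _ opt (Xb w)); exists z.
apply: countable_bigcupT_measurable => [|z]; first exact: countableP.
(* The conditions that do not involve [w] either fail, making [F z] empty, or leave only finitely
   many coordinate bounds. *)
have [[za Az zI]|no] := pselect [/\ cost c (rat_dir R z) < a,
    otA R n *m rat_dir R z = 0 & forall l, l \notin I -> rat_dir R z l 0 = 0]; last first.
  by rewrite (_ : F z = set0) //; apply/seteqP; split=> // w [[? ? ?] ?]; apply: no.
rewrite (_ : F z = \bigcap_(l in [set: 'I_(n * n)])
    ((fun w => X w l 0) @^-1` `[- rat_dir R z l 0, +oo[%classic)); last first.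
  apply/seteqP; split=> w.
    by move=> [[Xz _ _] _] l _; have := Xz l; rewrite mxE /= in_itv /= andbT -lerBlDr sub0r.
  move=> Xz; split=> //; split=> // l; rewrite mxE -lerBlDr sub0r.
  by have := Xz l Logic.I; rewrite /= in_itv /= andbT.
apply: fin_bigcap_measurable => // l _.
by rewrite -[X in measurable X]setTI; apply: mX.
Qed.

(** * Independence and conditional expectation *)

Lemma ge0_integral_mrestr {R : realType} {disp : measure_display}
    {T : measurableType disp} (mu : measure T R) (E A : set T) (mE : measurable E)
    (f : T -> \bar R) :
  measurable A -> measurable_fun A f -> (forall w, A w -> (0 <= f w)%E) ->
  (\int[mrestr mu mE]_(w in A) f w = \int[mu]_(w in A `&` E) f w)%E.
Proof.
move=> mA mf f0; have mAE := measurableI _ _ mA mE; have mAD := measurableD mA mE.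
have AE : (A `&` E) `|` (A `\` E) = A by rewrite setUIDK.
have -> : (\int[mrestr mu mE]_(w in A) f w =
    \int[mrestr mu mE]_(w in A `&` E) f w + \int[mrestr mu mE]_(w in A `\` E) f w)%E.
  rewrite -ge0_integral_setU ?AE //.
  by apply/disj_setPS => w [[_ ?] []].
rewrite [X in (_ + X)%E](eq_measure_integral mzero) => [|B mB BAE]; last first.
  rewrite /= -[LHS]/(mu (B `&` E)) (_ : B `&` E = set0) ?measure0 //.
  by apply/seteqP; split=> // w [/BAE[_ nE] /nE].
rewrite integral_measure_zero adde0; apply: eq_measure_integral => B mB BAE.
by rewrite /= -[LHS]/(mu (B `&` E)) setIidl // => w /BAE[].
Qed.

Section Conditional.
Context {R : realType} {disp : measure_display} {T : measurableType disp}.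
Variables (P : probability T R) (G : set (set T)).
Hypothesis G_sub : <<s G>> `<=` measurable.

(** The same points as [T] with the smaller sigma-algebra: measurability on [U] is measurability
    with respect to [<<s G>>]. *)
Let U := g_sigma_algebraType G.

Lemma measurable_fun_sub (f : T -> R) :
  measurable_fun [set: U] (f : U -> R) -> measurable_fun [set: T] f.
Proof. by move=> mf _ B mB; apply: G_sub; apply: mf. Qed.

(** Pushed forward along the identity from [T] to [U], the restriction of [P] to [E] and the
    multiple of [P] by [k] are the same measure, and [f] is measurable there. *)
Lemma integral_indep (E A : set T) (k : {nonneg R}) (f : T -> R) :
  measurable E -> (forall B, <<s G>> B -> P (E `&` B) = (k%:num%:E * P B)%E) ->
  measurable_fun [set: U] (f : U -> R) -> (forall w, 0 <= f w) -> <<s G>> A ->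
  (\int[P]_(w in A `&` E) (f w)%:E = k%:num%:E * \int[P]_(w in A) (f w)%:E)%E.
Proof.
move=> mE indep mf f0 GA.
have mA := G_sub GA.
pose phi (w : T) : U := w.
have mphi : measurable_fun [set: T] phi.
  by move=> _ B mB; rewrite setTI; apply: G_sub.
have mf' : measurable_fun (A : set U) (fun w : U => (f w)%:E).
  by apply/measurable_EFinP; apply: measurable_funTS.
have mfT : measurable_fun [set: T] (EFin \o f).
  by apply/measurable_EFinP/measurable_fun_sub.
have f0' : {in (A : set U), forall y, (0%R <= (f y)%:E)%E}.
  by move=> y _; rewrite lee_fin.
transitivity (\int[pushforward (mrestr P mE) phi]_(w in (A : set U)) (f w)%:E)%E.
  rewrite (ge0_integral_pushforward mphi) //=.
  by rewrite ge0_integral_mrestr // => [|w _]; [apply: measurable_funTS | rewrite lee_fin].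
transitivity (\int[pushforward (mscale k P) phi]_(w in (A : set U)) (f w)%:E)%E.
  apply: eq_measure_integral => B mB _.
  by rewrite /mscale /= /pushforward /mrestr setIC indep.
rewrite (ge0_integral_pushforward mphi) //= ge0_integral_mscale //.
  exact: measurable_funTS.
by move=> w _; rewrite lee_fin.
Qed.

(** The set where [Y < Y'] belongs to the sub-sigma-algebra, so both versions have the same integral
    over it and their positive difference vanishes almost everywhere there. *)
Lemma cond_expectation_le (Z Y Y' : T -> R) :
  is_cond_expectation P <<s G>> Z Y -> is_cond_expectation P <<s G>> Z Y' ->
  {ae P, forall w, Y' w <= Y w}.
Proof.
move=> [iZ iY mY eY] [_ iY' mY' eY'].
have mU (X : T -> R) : (forall B, measurable B -> <<s G>> (X @^-1` B)) ->
    measurable_fun [set: U] (X : U -> R).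
  by move=> mX _ B mB; rewrite setTI; apply: mX.
pose A := [set w | Y w < Y' w].
have GA : <<s G>> A.
  have := measurable_fun_ltr (mU _ mY) (mU _ mY') => /(_ (@measurableT _ U) [set true]).
  by rewrite setTI; apply.
have mA := G_sub GA.
have iA X : P.-integrable setT (EFin \o X) -> P.-integrable A (EFin \o X).
  exact: integrableS.
pose D w := Y' w - Y w.
have mD : measurable_fun A (EFin \o D).
  apply/measurable_EFinP; apply: measurable_funB; apply: measurable_funTS.
    exact: measurable_fun_sub (mU _ mY').
  exact: measurable_fun_sub (mU _ mY).
have : (\int[P]_(w in A) `|(EFin \o D) w| = 0)%E.
  rewrite (eq_integral (fun w => (Y' w)%:E - (Y w)%:E)%E) => [|w]; last first.
    by rewrite inE => wA; rewrite /= ger0_norm ?EFinB // subr_ge0 ltW.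
  rewrite integralB //; [|exact: iA|exact: iA].
  by rewrite (eY' _ GA) -(eY _ GA) subee //; apply: integrable_fin_num => //; apply: iA.
move=> /(ae_eq_integral_abs P mA mD); apply: filterS => w /= DA.
rewrite leNgt; apply/negP => wA; have := DA wA; rewrite /D => -[] /eqP.
by rewrite subr_eq0 => /eqP e; move: wA; rewrite e ltxx.
Qed.

End Conditional.

Lemma integrable_bounded {R : realType} {disp : measure_display}
    {T : measurableType disp} (P : probability T R) (f : T -> R) (M : R) :
  measurable_fun setT f -> (forall w, `|f w| <= M) -> P.-integrable setT (EFin \o f).
Proof.
move=> mf fM.
apply: (le_integrable _ _ _ (finite_measure_integrable_cst P M measurableT)) => //.
  exact/measurable_EFinP.
by move=> w _; rewrite /= lee_fin (le_trans (fM w)) // ler_norm.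
Qed.

Lemma measurable_cost {R : realType} {disp : measure_display} {U : measurableType disp}
    N (c : 'cV[R]_N) (X : U -> 'cV[R]_N) :
  (forall l, measurable_fun setT (fun w => X w l 0)) ->
  measurable_fun setT (fun w => cost c (X w)).
Proof.
move=> mX; rewrite (_ : (fun w => _) = fun w => \sum_l c l 0 * X w l 0).
  by apply: measurable_sum => l; apply: measurable_funM => //; apply: measurable_cst.
by apply/funext => w; rewrite /cost mxE; apply: eq_bigr => l _; rewrite mxE.
Qed.

(** * Runs of the algorithm *)

Section Run.
Context {R : realType} {disp : measure_display} {T : measurableType disp}.
Variables (P : probability T R) (n p : nat) (b : 'cV[R]_(n + n)).
Variables (c xopt : 'cV[R]_(n * n)) (s t : nat -> T -> 'S_n).
Variables d x : nat -> T -> 'cV[R]_(n * n).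
Hypotheses (pn : (3 <= p <= n)%N) (opt : ot_optimal b c xopt).
Hypothesis run : rbcd_band P p b c s t d x.

Let rate : R := n%:R * (p%:R - 2) / ((n%:R ^+ 2 - 3) * (n`!)%:R ^+ 2).

Lemma run_feasible k w : ot_feasible b (x k w).
Proof.
elim: k => [|k [xb x0]]; first exact: (rbcd_init run).
have [[xd Ad _] _] := rbcd_dir run k w.
by rewrite (rbcd_step run); split; rewrite ?mulmxDr ?Ad ?addr0.
Qed.

(** Named so that [history x k] is the sigma-algebra of a [g_sigma_algebraType]. *)
Let hist_gen k : set (set T) := [set A | exists i l (B : set R),
  [/\ (i <= k)%N, measurable B & A = (fun w => x i w l 0) @^-1` B]].

Let hist_sub k : <<s hist_gen k >> `<=` measurable.
Proof.
apply: smallest_sub; first exact: sigma_algebra_measurable.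
move=> _ [i [l [B [_ mB ->]]]]; rewrite -[X in measurable X]setTI.
exact: (rbcd_rand run).
Qed.

Let hist_measurable k l :
  measurable_fun [set: g_sigma_algebraType (hist_gen k)] (fun w => x k w l 0).
Proof.
move=> _ B mB; rewrite setTI; apply: sub_sigma_algebra.
by exists k, l, B.
Qed.

Let q k w := qval c (x k w) (band_select R n p (s k w) (t k w)).

(** The explicit version of the conditional expectation of [q k]: the iterate is frozen and the draw
    averaged out. *)
Let avg k w := (n`!)%:R ^- 2 *
  \sum_(uv : 'S_n * 'S_n) qval c (x k w) (band_select R n p uv.1 uv.2).

Let B := (\sum_l `|c l 0|) * \sum_l `|b l 0|.

Let cost_bound k w : `|cost c (x k w)| <= B.
Proof. exact/feasible_cost_bound/run_feasible. Qed.

(** The optimal [d k w] attains the value. Measurability and integrability of [q] and the recursion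
    of the gap all come from this difference. *)
Let qE k w : q k w = cost c (x k.+1 w) - cost c (x k w).
Proof.
by rewrite /q (qval_Dopt (rbcd_dir run k w)) (rbcd_step run) costD addrAC subrr add0r.
Qed.

Let q_le0 k w I : qval c (x k w) I <= 0.
Proof. exact/(qval_le0 opt)/run_feasible. Qed.

Let measurable_q k : measurable_fun setT (q k).
Proof.
rewrite (_ : q k = fun w => cost c (x k.+1 w) - cost c (x k w)); last exact/funext/qE.
by apply: measurable_funB; apply: measurable_cost; apply: (rbcd_rand run).
Qed.

Let integrable_q k : P.-integrable setT (EFin \o q k).
Proof.
apply: (@integrable_bounded _ _ _ _ _ (B + B)) => // w.
by rewrite qE (le_trans (ler_normB _ _)) // lerD.
Qed.

Let measurable_qI k I :
  measurable_fun [set: g_sigma_algebraType (hist_gen k)] (fun w => qval c (x k w) I).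
Proof.
apply: (measurable_qval _ opt); first exact: run_feasible.
exact: hist_measurable.
Qed.

Let measurable_avg k : measurable_fun [set: g_sigma_algebraType (hist_gen k)] (avg k).
Proof.
apply: measurable_funM; first exact: measurable_cst.
by apply: measurable_sum => uv; apply: measurable_qI.
Qed.

Let avg_le0 k w : avg k w <= 0.
Proof.
by rewrite /avg mulr_ge0_le0 ?sumr_le0 // invr_ge0 exprn_ge0.
Qed.

Let integrable_avg k : P.-integrable setT (EFin \o avg k).
Proof.
pose M : R := (n`!)%:R ^- 2 * \sum_(uv : 'S_n * 'S_n) (B + B).
apply: (@integrable_bounded _ _ _ _ _ M) => [|w].
  exact: measurable_fun_sub (@hist_sub k) _ (@measurable_avg k).
rewrite /avg normrM ger0_norm ?invr_ge0 ?exprn_ge0 //.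
rewrite ler_wpM2l ?invr_ge0 ?exprn_ge0 // (le_trans (ler_norm_sum _ _ _)) //.
apply: ler_sum => uv _; rewrite ler0_norm // lerNl.
have xf := run_feasible k w.
apply: le_trans (qval_ge opt _ xf); rewrite opprD lerD // lerNl.
  by apply: le_trans (ler_norm _) _; rewrite normrN; apply/feasible_cost_bound; case: opt.
by rewrite opprK (le_trans (ler_norm _)).
Qed.

Let event k (uv : 'S_n * 'S_n) := (s k @^-1` [set uv.1]) `&` (t k @^-1` [set uv.2]).

Let measurable_event k uv : measurable (event k uv).
Proof.
by apply: measurableI; [have [] := rbcd_row run k uv.1|have [] := rbcd_col run k uv.2].
Qed.

Let kap : {nonneg R} := ((n`!)%:R ^- 2 : R)%:nng.

Let event_indep k uv A : <<s hist_gen k >> A -> P (event k uv `&` A) = (kap%:num%:E * P A)%E.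
Proof.
move=> hA; rewrite (rbcd_indep run (k := k)) //.
have [_ ->] := rbcd_row run k uv.1; have [_ ->] := rbcd_col run k uv.2.
by rewrite -EFinM /= expr2 invfM.
Qed.

(** Split [A] by the pair drawn. On each piece [q k] is a history-measurable function with the pair
    fixed, and independence replaces the piece by the factor 1/(n!)^2. *)
Let integral_q_avg k A : <<s hist_gen k >> A ->
  (\int[P]_(w in A) (avg k w)%:E = \int[P]_(w in A) (q k w)%:E)%E.
Proof.
move=> hA; have mA := hist_sub hA.
(* Signs are reversed so that the integration rules for nonnegative functions apply. *)
pose g uv w : R := - qval c (x k w) (band_select R n p uv.1 uv.2).
have g_ge0 uv w : 0 <= g uv w by rewrite oppr_ge0.
have mg uv : measurable_fun [set: g_sigma_algebraType (hist_gen k)] (g uv).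
  by apply: measurable_funN; apply: measurable_qI.
have mgT uv : measurable_fun A (EFin \o g uv).
  apply/measurable_EFinP/measurable_funTS.
  exact: measurable_fun_sub (@hist_sub k) _ (mg uv).
have AE : \big[setU/set0]_(uv <- index_enum {: 'S_n * 'S_n}) (A `&` event k uv) = A.
  rewrite -bigcup_seq; apply/seteqP; split=> [w [uv _ []]//|w Aw].
  by exists (s k w, t k w) => //=; rewrite mem_index_enum.
have Nq : (\int[P]_(w in A) (- q k w)%:E =
    \sum_(uv : 'S_n * 'S_n) \int[P]_(w in A) (kap%:num * g uv w)%:E)%E.
  rewrite -{1}AE ge0_integral_bigsetU ?AE //=; first last.
  - by move=> w _; rewrite lee_fin oppr_ge0; apply: q_le0.
  - by apply/measurable_EFinP/measurable_funTS/measurable_funN.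
  - apply/trivIsetP => -[u v] [u' v'] _ _ ne; apply/seteqP; split=> // w.
    move=> [[_ [/= e1 e2]] [_ [/= e3 e4]]]; move/eqP: ne; apply.
    by rewrite -e1 -e2 -e3 -e4.
  - exact: index_enum_uniq.
  - by move=> uv; apply: measurableI.
  apply: eq_bigr => uv _.
  rewrite (eq_integral (fun w => (g uv w)%:E)) => [|w]; last first.
    by rewrite inE => -[_ [/= e1 e2]]; rewrite /q /g e1 e2.
  rewrite (integral_indep (@hist_sub k) (measurable_event k uv) (@event_indep k uv)) //.
  rewrite -ge0_integralZl //; first exact: mgT.
  by move=> w _; rewrite lee_fin.
have Navg : (\int[P]_(w in A) (- avg k w)%:E =
    \sum_(uv : 'S_n * 'S_n) \int[P]_(w in A) (kap%:num * g uv w)%:E)%E.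
  rewrite -ge0_integral_sum //; first last.
  - by move=> uv w _; rewrite lee_fin mulr_ge0.
  - move=> uv; rewrite (_ : (fun w => _) = fun w => (kap%:num%:E * (EFin \o g uv) w)%E) //.
    exact: measurable_funeM.
  apply: eq_integral => w _; rewrite sumEFin; congr EFin.
  by rewrite /avg -mulrN -sumrN mulr_sumr.
have oppE (f : T -> R) : (forall w, f w <= 0) ->
    (\int[P]_(w in A) (f w)%:E = - \int[P]_(w in A) (- f w)%:E)%E.
  move=> f0; rewrite -integral_ge0N => [|w _]; last by rewrite lee_fin oppr_ge0.
  by apply: eq_integral => w _; rewrite EFinN oppeK.
rewrite (oppE (avg k)) // (oppE (q k)) ?Navg ?Nq // => w; exact: q_le0.
Qed.

Lemma history_measurable k : history x k `<=` measurable.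
Proof. exact: hist_sub. Qed.

Lemma cond_expectation_avg k : is_cond_expectation P (history x k) (q k) (avg k).
Proof.
split=> //; last exact: integral_q_avg.
move=> A mA; rewrite -[X in history x k X]setTI.
exact: measurable_avg.
Qed.

Lemma avg_le k w : avg k w <= rate * qval c (x k w) [set: 'I_(n * n)]%SET.
Proof.
have := sum_qval_le pn opt (run_feasible k w); set Q := qval c _ _ => sum_le.
have -> : rate * Q = (n`!)%:R ^- 2 * (n%:R * (p%:R - 2) / (n%:R ^+ 2 - 3) * Q).
  rewrite /rate invfM; move: (_ ^- 2) (_ - 3)^-1 => u v; ring.
by rewrite ler_wpM2l // invr_ge0 exprn_ge0.
Qed.

Lemma rate_bounds : 0 < rate <= 1.
Proof.
have K : (n%:R ^+ 2 - 3 : R) = (n * n - 3)%:R by rewrite natrB ?natrM //; nia.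
have num : n%:R * (p%:R - 2) = (n * (p - 2))%:R :> R by rewrite natrM natrB //; lia.
have K_gt0 : (0 < n * n - 3)%N by nia.
have den_gt0 : (0 < (n * n - 3) * n`! ^ 2)%N by rewrite muln_gt0 K_gt0 expn_gt0 fact_gt0.
rewrite /rate K num -natrX -natrM divr_gt0 ?ltr0n //=; last by nia.
rewrite ler_pdivrMr ?mul1r ?ler_nat ?ltr0n //.
(* From p <= n and n >= 3: n(p - 2) <= n^2 - 2n <= n^2 - 3. *)
apply: (@leq_trans (n * n - 3)); first by nia.
by rewrite leq_pmulr // expn_gt0 fact_gt0.
Qed.

(** * Decay of the optimality gap *)

Let gap k w := cost c (x k w - xopt).

Let gap_ge0 k w : 0 <= gap k w.
Proof. by rewrite /gap costB subr_ge0; apply: (proj2 opt); apply: run_feasible. Qed.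

Let measurable_gap k : measurable_fun setT (gap k).
Proof.
rewrite (_ : gap k = fun w => cost c (x k w) - cost c xopt); last first.
  by apply/funext => w; rewrite /gap costB.
apply: measurable_funB; last exact: measurable_cst.
by apply: measurable_cost; apply: (rbcd_rand run).
Qed.

Let integrable_gap k : P.-integrable setT (EFin \o gap k).
Proof.
apply: (@integrable_bounded _ _ _ _ _ (B + B)) => // w.
rewrite /gap costB (le_trans (ler_normB _ _)) // lerD //.
by apply/feasible_cost_bound; case: opt.
Qed.

Let mean k := fine (\int[P]_w (gap k w)%:E).

Let meanE k : (\int[P]_w (gap k w)%:E = (mean k)%:E)%E.
Proof. rewrite fineK //; exact: (integrable_fin_num measurableT (integrable_gap k)). Qed.

(** The gap changes by [q k], whose integral equals that of [avg k], and [avg k] is at most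
    [- rate * gap k] pointwise. *)
Let mean_step k : mean k.+1 <= (1 - rate) * mean k.
Proof.
rewrite -lee_fin -meanE (eq_integral (fun w => (gap k w)%:E + (q k w)%:E)%E); last first.
  by move=> w _; rewrite -EFinD qE /gap !costB; congr EFin; ring.
rewrite integralD //; [|exact: integrable_gap|exact: integrable_q].
rewrite meanE mulrBl mul1r EFinB leeD2l // -integral_q_avg; last first.
  exact: (@measurableT _ (g_sigma_algebraType (hist_gen k))).
have -> : (- (rate * mean k)%:E = \int[P]_w ((- rate)%:E * (EFin \o gap k) w))%E.
  by rewrite integralZl // meanE -EFinM mulNr EFinN.
apply: le_integral => //; first exact: integrable_avg.
  exact/integrableZl/integrable_gap.
move=> w _; rewrite lee_fin (le_trans (avg_le k w)) //.
by rewrite (qval_setT opt (run_feasible k w)) /gap costB mulNr -mulrN opprB.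
Qed.

Let mean_geometric k : mean k <= (1 - rate) ^+ k * mean 0%N.
Proof.
have /andP[_ rate_le1] := rate_bounds.
elim: k => [|k IH]; first by rewrite expr0 mul1r.
apply: le_trans (mean_step k) _; rewrite exprS -mulrA ler_wpM2l //.
by rewrite subr_ge0.
Qed.

Lemma expected_gap_le k :
  ('E_P[fun w => cost c (x k w - xopt)] <=
   ((1 - rate) ^+ k)%:E * 'E_P[fun w => cost c (x 0%N w - xopt)])%E.
Proof. by rewrite unlock !meanE -EFinM lee_fin; apply: mean_geometric. Qed.

Lemma gap_cvg0 : {ae P, forall w, cost c (x k w - xopt) @[k --> \oo] --> (0 : R)}.
Proof.
(* As an infimum, the limit along a run lies below every [gap k], so its integral is below all the
   means and hence 0. *)
pose l w := inf (range (gap ^~ w)).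
have lb w : has_lbound (range (gap ^~ w)) by exists 0 => _ [k _ <-].
have cvg_l w : gap ^~ w @ \oo --> l w.
  apply: nonincreasing_cvgn => //; apply/nonincreasing_seqP => k.
  rewrite /gap !costB lerD2r -subr_le0 -qE; exact: q_le0.
have l_ge0 w : 0 <= l w.
  by apply: lb_le_inf; [exists (gap 0%N w), 0%N | move=> _ [k _ <-]].
have l_le k w : l w <= gap k w by apply: ge_inf => //; exists k.
have ml : measurable_fun setT l.
  by apply: measurable_fun_cvg => [k|w _]; [exact: measurable_gap | exact: cvg_l].
have il : P.-integrable setT (EFin \o l).
  apply: (le_integrable _ _ _ (integrable_gap 0%N)) => //; first exact/measurable_EFinP.
  by move=> w _; rewrite /= lee_fin !ger0_norm.
have int_l_le k : fine (\int[P]_w (l w)%:E) <= (1 - rate) ^+ k * mean 0%N.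
  apply: le_trans (mean_geometric k).
  rewrite -lee_fin -meanE fineK; last exact: integrable_fin_num.
  apply: le_integral => //; first exact: integrable_gap.
  by move=> w _; rewrite lee_fin.
have /andP[rate_gt0 rate_le1] := rate_bounds.
have int_l_le0 : fine (\int[P]_w (l w)%:E) <= 0.
  have geo : (1 - rate) ^+ k * mean 0%N @[k --> \oo] --> (0 : R).
    rewrite -[X in _ --> X](mul0r (mean 0%N)); apply: cvgMl; apply: cvg_expr.
    by rewrite ger0_norm ?subr_ge0 // ltrBlDr ltrDl.
  by apply: (cvgr_to_ge geo); apply: nearW.
have : (\int[P]_w `|(EFin \o l) w| = 0)%E.
  rewrite (eq_integral (fun w => (l w)%:E)) => [|w _]; last by rewrite /= ger0_norm.
  apply/eqP; rewrite eq_le; apply/andP; split.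
    by rewrite -(fineK (integrable_fin_num measurableT il)) lee_fin.
  by apply: integral_ge0 => w _; rewrite lee_fin.
have mlE : measurable_fun setT (EFin \o l) by exact/measurable_EFinP.
move=> /(ae_eq_integral_abs P measurableT mlE); apply: filterS => w /= /(_ Logic.I)[l0].
by have := cvg_l w; rewrite l0.
Qed.

End Run.

Theorem theorem5 (R : realType) (n p : nat) (r1 r2 : 'cV[R]_n) (C : 'M[R]_n)
    (disp : measure_display) (T : measurableType disp) (P : probability T R)
    (s t : nat -> T -> 'S_n) (d x : nat -> T -> 'cV[R]_(n * n))
    (n_ge3 : (3 <= n)%N) (p_bounds : (3 <= p <= n)%N)
    (r1_ge0 : nonneg r1) (r2_ge0 : nonneg r2)
    (has_opt : exists xopt, ot_optimal (col_mx r1 r2) (vec C) xopt)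
    (run : rbcd_band P p (col_mx r1 r2) (vec C) s t d x) :
  exists v : R,
    [/\ 0 < v <= 1,
        n%:R * (p%:R - 2) / ((n%:R ^+ 2 - 3) * (n`!)%:R ^+ 2) <= v,
        forall k : nat,
          let qk := fun w =>
            qval (vec C) (x k w) (band_select R n p (s k w) (t k w)) in
          (exists Y : T -> R, is_cond_expectation P (history x k) qk Y) /\
          (forall Y : T -> R, is_cond_expectation P (history x k) qk Y ->
             {ae P, forall w, Y w <= v * qval (vec C) (x k w) [set: 'I_(n * n)]%SET}) &
        forall xs, ot_optimal (col_mx r1 r2) (vec C) xs ->
          {ae P, forall w, cost (vec C) (x k w - xs) @[k --> \oo] --> (0 : R)} /\
          (forall k : nat,
             ('E_P[fun w => cost (vec C) (x k w - xs)] <=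
              ((1 - v) ^+ k)%:E * 'E_P[fun w => cost (vec C) (x 0%N w - xs)])%E)].
Proof.
have [xopt opt] := has_opt.
(* The guaranteed lower bound itself serves as v. *)
exists (n%:R * (p%:R - 2) / ((n%:R ^+ 2 - 3) * (n`!)%:R ^+ 2)); split => //.
- exact: rate_bounds.
- move=> k qk; have condY := cond_expectation_avg opt run k.
  split; first by eexists; exact: condY.
  (* The averaged version satisfies the bound everywhere, and any other version is almost surely
     below it. *)
  move=> Y /(cond_expectation_le (history_measurable run (k := k)) condY).
  apply: filterS => w /le_trans; apply.
  exact: (avg_le p_bounds opt run).
- move=> xs xs_opt; split; first exact: (gap_cvg0 p_bounds xs_opt run).
  by move=> k; apply: (expected_gap_le p_bounds xs_opt run).
Qed.
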